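(* Consider the problem of maximizing $\sum_{i,j:\,e^R_{ij}\in E^R}U_{ij}f^R_{ij}$ over all integer-valued circulation flows $f$ in a social-request graph $G=(V,E^S\cup E^R)$ (indivisible sensing service), where all capacities $R_{ij},S_{ij}$ and all utilities $U_{ij}$ are rational. Let $\overline U=\max_{e^R_{ij}\in E^R}U_{ij}$, $\overline R=\max_{e^R_{ij}\in E^R}R_{ij}$, and let $K$ be a positive integer such that $KU_{ij}$ is an integer for all $e^R_{ij}\in E^R$. Then the cycle-canceling algorithm described in the context, applied to the problem in which every capacity is replaced by its floor and every utility is multiplied by $K$, computes the optimal (integer-valued) flow and has running time \[O\bigl(|V|\,|E^R|\,(|E^R|+|E^S|)\,\lfloor\overline R\rfloor\,\overline U\,K\bigr).\]
   Context: $V$ is a finite set of users. The request graph $(V,E^R)$ is directed, has no loops, and has at most one request edge $e^R_{ij}$ from $i$ to $j$, with capacity $R_{ij}>0$ and utility per unit flow $U_{ij}$. The social graph $(V,E^S)$ is directed, has no loops, and has at most one social edge $e^S_{ij}$ from $i$ to $j$, with capacity $S_{ij}$. Convention: social edges come in pairs, i.e. $e^S_{ij}\in E^S$ iff $e^S_{ji}\in E^S$; a missing reverse edge is represented by an edge of capacity $0$, and all other social capacities are positive (before rounding; edges whose capacity is rounded to $0$ are allowed). $G=(V,E^S\cup E^R)$ is the directed multigraph containing all these edges. A circulation flow in $G$ is $f=(f^S_{ij},f^R_{ij})$ with $-S_{ji}\le f^S_{ij}\le S_{ij}$ and $f^S_{ji}=-f^S_{ij}$ for all $e^S_{ij}\in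 E^S$; $0\le f^R_{ij}\le R_{ij}$ for all $e^R_{ij}\in E^R$; and, for all $i\in V$, $\sum_{j:e^R_{ij}\in E^R}f^R_{ij}+\sum_{j:e^S_{ij}\in E^S}f^S_{ij}=\sum_{j:e^R_{ji}\in E^R}f^R_{ji}$. Residual graph $G_f$ of a circulation flow $f$: a weighted directed multigraph on $V$. Each request edge $e^R_{ij}$ gives a forward edge $i\to j$ of capacity $R_{ij}-f^R_{ij}$ and weight $U_{ij}$, and a backward edge $j\to i$ of capacity $f^R_{ij}$ and weight $-U_{ij}$. Each social edge $e^S_{ij}$ gives an edge $i\to j$ of capacity $S_{ij}-f^S_{ij}$ and weight $0$. Edges of capacity zero are omitted. The weight of a cycle is the sum of its edge weights; its residual capacity is the minimum capacity of its edges. Augmenting $f$ with a balanced flow of value $r$ along a directed cycle $c$ of $G_f$ means: for each forward request edge of $c$ increase the corresponding $f^R_{ij}$ by $r$; for each backward request edge of $c$ decrease the corresponding $f^R_{ij}$ by $r$; for each social edge $i\to j$ of $c$ increase $f^S_{ij}$ by $r$ and decrease $f^S_{ji}$ by $r$. Cycle-canceling algorithm: start with the zero flow $f$. While $G_f$ contains a (simple) directed cycle of positive weight, find such a cycle $c$, compute its residual capacity $r_c$, and augment $f$ with a balanced flow of value $r_c$ along $c$. Return $f$. Testing for and finding a positive-weight cycle is done by a Bellman–Ford-type procedure that finds one whenever it exists, in time $O(|V|(|E^S|+|E^R|))$. Running time counts arithmetic operations and comparisons as unit cost.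
   Formalization: The running-time bound is asserted only when the expression inside O(·) is defined and positive; if E^R is empty, ⌊R̄⌋ = 0 or Ū ≤ 0 it is undefined or at most 0 although one cycle test is always run, and there only termination and optimality are claimed. *)

(* Defs.v *)
From HB Require Import structures.
From mathcomp Require Import all_boot all_order all_algebra.

Set Implicit Arguments.
Unset Strict Implicit.
Unset Printing Implicit Defensive.

Import Order.TTheory GRing.Theory Num.Theory.
Local Open Scope ring_scope.

(* A value together with the number of arithmetic operations and comparisons
   spent to compute it; reads, writes and control flow are free. *)
Definition timed (A : Type) : Type := (A * nat)%type.

Definition ret (A : Type) (x : A) : timed A := (x, 0%N).

Definition bind (A B : Type) (m : timed A) (k : A -> timed B) : timed B :=
  let: (x, t) := m in let: (y, t') := k x in (y, (t + t')%N).

Definition add_t (x y : rat) : timed rat := (x + y, 1%N).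
Definition sub_t (x y : rat) : timed rat := (x - y, 1%N).
Definition min_t (x y : rat) : timed rat := (Num.min x y, 1%N).

Definition rev_edge (V : finType) (e : V * V) : V * V := (e.2, e.1).

(* Capacities, utilities and flow values matter only on the edges ER, ES;
   what these total functions return on other pairs is irrelevant. *)
Record network (V : finType) := Network {
  ER : {set V * V};
  capR : V * V -> rat;
  util : V * V -> rat;
  ES : {set V * V};
  capS : V * V -> rat
}.

Record flow (V : finType) := Flow {
  fS : V * V -> rat;
  fR : V * V -> rat
}.

(* Capacities may vanish here, so that rounded networks are included. *)
Definition well_formed (V : finType) (N : network V) : Prop :=
  [/\ forall i, (i, i) \notin ER N,
      forall i, (i, i) \notin ES N,
      forall e, (rev_edge e \in ES N) = (e \in ES N),
      forall e, e \in ER N -> 0 <= capR N e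
    & forall e, e \in ES N -> 0 <= capS N e].

(* A social edge of capacity 0 stands for a missing reverse edge, so the two
   edges of a pair are not both of capacity 0. *)
Definition social_request_graph (V : finType) (N : network V) : Prop :=
  [/\ well_formed N,
      forall e, e \in ER N -> 0 < capR N e
    & forall e, e \in ES N -> 0 < capS N e \/ 0 < capS N (rev_edge e)].

Definition circulation (V : finType) (N : network V) (f : flow V) : Prop :=
  [/\ forall e, e \in ES N -> - capS N (rev_edge e) <= fS f e <= capS N e,
      forall e, e \in ES N -> fS f (rev_edge e) = - fS f e,
      forall e, e \in ER N -> 0 <= fR f e <= capR N e
    & forall i, \sum_(j | (i, j) \in ER N) fR f (i, j)
                + \sum_(j | (i, j) \in ES N) fS f (i, j)
                = \sum_(j | (j, i) \in ER N) fR f (j, i)].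

Definition integer_circulation (V : finType) (N : network V) (f : flow V)
    : Prop :=
  [/\ circulation N f,
      forall e, e \in ER N -> fR f e \is a Num.int
    & forall e, e \in ES N -> fS f e \is a Num.int].

Definition total_utility (V : finType) (N : network V) (f : flow V) : rat :=
  \sum_(e in ER N) util N e * fR f e.

Definition optimal_integer_flow (V : finType) (N : network V) (f : flow V)
    : Prop :=
  integer_circulation N f /\
  forall g, integer_circulation N g -> total_utility N g <= total_utility N f.

(* Edges of the residual multigraph, named after the edge they come from;
   [Backward e] runs against e. *)
Inductive residual_edge (V : finType) :=
  | Forward of V * V
  | Backward of V * V
  | Social of V * V.

Section Residual.
Variables (V : finType) (N : network V) (f : flow V).
Implicit Types (a : residual_edge V) (c : seq (residual_edge V)).

Definition source a : V :=
  match a with Forward e | Social e => e.1 | Backward e => e.2 end.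

Definition target a : V :=
  match a with Forward e | Social e => e.2 | Backward e => e.1 end.

Definition weight a : rat :=
  match a with
  | Forward e => util N e | Backward e => - util N e | Social _ => 0
  end.

Definition res_cap_t a : timed rat :=
  match a with
  | Forward e => sub_t (capR N e) (fR f e)
  | Backward e => ret (fR f e)
  | Social e => sub_t (capS N e) (fS f e)
  end.

Definition res_cap a : rat := (res_cap_t a).1.

Definition in_residual a : bool :=
  match a with
  | Forward e | Backward e => e \in ER N
  | Social e => e \in ES N
  end && (0 < res_cap a).

Definition simple_cycle c : bool :=
  [&& (0 < size c)%N, all in_residual c,
      cycle (fun a b => target a == source b) c & uniq (map source c)].

Definition positive_cycle c : bool :=
  simple_cycle c && (0 < \sum_(a <- c) weight a).

Fixpoint min_cap_t (r : rat) c : timed rat :=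
  if c is a :: c' then
    bind (res_cap_t a) (fun x => bind (min_t r x) (fun r' => min_cap_t r' c'))
  else ret r.

(* The value on the empty sequence is irrelevant: cycles are nonempty. *)
Definition cycle_cap_t c : timed rat :=
  if c is a :: c' then bind (res_cap_t a) (fun r => min_cap_t r c') else ret 0.

End Residual.

Definition push_t (V : finType) (r : rat) (a : residual_edge V) (f : flow V)
    : timed (flow V) :=
  match a with
  | Forward e =>
      bind (add_t (fR f e) r) (fun x =>
      ret (Flow (fS f) [eta fR f with e |-> x]))
  | Backward e =>
      bind (sub_t (fR f e) r) (fun x =>
      ret (Flow (fS f) [eta fR f with e |-> x]))
  | Social e =>
      bind (add_t (fS f e) r) (fun x =>
      bind (sub_t (fS f (rev_edge e)) r) (fun y =>
      ret (Flow [eta fS f with e |-> x, rev_edge e |-> y] (fR f))))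
  end.

Fixpoint augment_t (V : finType) (r : rat) (c : seq (residual_edge V))
    (f : flow V) : timed (flow V) :=
  if c is a :: c' then bind (push_t r a f) (augment_t r c') else ret f.

(* The Bellman-Ford-type subroutine is kept abstract: only its specification
   and its running time are used. *)
Definition cycle_finder : Type :=
  forall V : finType,
    network V -> flow V -> timed (option (seq (residual_edge V))).

Definition finds_positive_cycles (find : cycle_finder) : Prop :=
  forall (V : finType) (N : network V) (f : flow V),
    well_formed N -> circulation N f ->
    match (find V N f).1 return Prop with
    | Some c => positive_cycle N f c
    | None => forall c, ~~ positive_cycle N f c
    end.

(* A bound O(B) on a running time is read as C * B, with C a constant, on all
   inputs with B > 0: no bound proportional to B can hold where B vanishes,
   since at least one test for a positive cycle is always performed. *)
Definition finder_time_O_VE (find : cycle_finder) : Prop :=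
  exists C : nat, forall (V : finType) (N : network V) (f : flow V),
    well_formed N -> circulation N f ->
    let B := (#|V| * (#|ES N| + #|ER N|))%N in
    (0 < B)%N -> ((find V N f).2 <= C * B)%N.

Section CycleCanceling.
Variables (find : cycle_finder) (V : finType) (N : network V).

Definition iteration_t (f : flow V) : timed (option (flow V)) :=
  bind (find N f) (fun oc =>
    if oc is Some c then
      bind (cycle_cap_t N f c) (fun r =>
      bind (augment_t r c f) (fun f' => ret (Some f')))
    else ret None).

(* [cancel_loop f g t]: the while loop entered with flow f terminates with
   flow g, in total time t. *)
Inductive cancel_loop : flow V -> flow V -> nat -> Prop :=
  | LoopStop f t : iteration_t f = (None, t) -> cancel_loop f f t
  | LoopStep f f' g t t' :
      iteration_t f = (Some f', t) -> cancel_loop f' g t' ->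
      cancel_loop f g (t + t')%N.

Definition zero_flow : flow V := Flow (fun=> 0) (fun=> 0).

Definition cycle_canceling (g : flow V) (t : nat) : Prop :=
  cancel_loop zero_flow g t.

End CycleCanceling.

Definition rounded (V : finType) (N : network V) (K : nat) : network V :=
  Network (ER N) (fun e => (Num.floor (capR N e))%:~R)
          (fun e => K%:R * util N e)
          (ES N) (fun e => (Num.floor (capS N e))%:~R).

Definition is_max (T : finType) (A : {set T}) (g : T -> rat) (m : rat) : Prop :=
  (exists2 x, x \in A & g x = m) /\ (forall x, x \in A -> g x <= m).

Definition time_bound (V : finType) (N : network V) (K : nat)
    (Ubar Rbar : rat) : rat :=
  #|V|%:R * #|ER N|%:R * (#|ER N|%:R + #|ES N|%:R)
    * (Num.floor Rbar)%:~R * Ubar * K%:R.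

(* Main.v *)
(* Flooring the capacities does not change the integer circulations, and scaling
   the utilities by K does not change the maximizers. In the rounded network
   all data are integral, so every augmentation keeps the flow integral and
   raises the scaled utility by at least 1; since that utility starts at 0 and
   never exceeds |ER| floor(Rbar) K Ubar, this bounds the number of iterations.
   An iteration costs O(|V| (|ES| + |ER|)), because a simple cycle has at most
   |V| edges. When the loop stops the flow is optimal: the difference to a
   better circulation would be a nonnegative divergence-free function of
   positive total weight on the residual edges, and peeling off cycles of
   nonpositive weight from it leaves one of positive weight. *)

From HB Require Import structures.
From mathcomp Require Import all_boot all_order all_algebra.
From mathcomp Require Import ring lra.
Require Import Defs.

Set Implicit Arguments.
Unset Strict Implicit.
Unset Printing Implicit Defensive.

Import Order.TTheory GRing.Theory Num.Theory.
Local Open Scope ring_scope.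

(** * Cycles in the support of divergence-free functions *)

Section CycleDecomposition.
Variables (F : realFieldType) (V A : finType) (src tgt : A -> V).
Implicit Types (h : A -> F) (c : seq A).

(** Edges form a type of their own with end maps [src] and [tgt], so parallel edges stay
    distinct. *)
Definition divergence h (v : V) : F :=
  \sum_a h a * ((src a == v)%:R - (tgt a == v)%:R).

Definition directed_cycle c : bool :=
  [&& (0 < size c)%N, cycle (fun a b => tgt a == src b) c & uniq (map src c)].

Definition cycle_flow (r : F) c (a : A) : F := r * (a \in c)%:R.

Lemma map_target_cycle c :
  cycle (fun a b => tgt a == src b) c -> map tgt c = rot 1 (map src c).
Proof.
case: c => [//|a c] /=; rewrite rot1_cons.
(* The closing edge [b] is separated from the start of the path, which varies in the induction. *)
move: {2 4}a => b; elim: c a => [|x c IH] a /=; first by rewrite andbT => /eqP ->.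
by case/andP=> /eqP -> /IH ->.
Qed.

Lemma sum_cycle_flow r c (G : A -> F) :
  uniq c -> \sum_a cycle_flow r c a * G a = r * \sum_(a <- c) G a.
Proof.
move=> uc; rewrite [X in _ = r * X]big_uniq // mulr_sumr [RHS]big_mkcond /=.
apply: eq_bigr => a _; rewrite /cycle_flow.
by case: (a \in c); rewrite ?mulr1 // mulr0 mul0r.
Qed.

Lemma directed_cycle_uniq c : directed_cycle c -> uniq c.
Proof. by case/and3P=> _ _; exact: map_uniq. Qed.

(** The targets along a cycle are its sources rotated by one, so the two indicator sums cancel. *)
Lemma divergence_cycle_flow r c v :
  directed_cycle c -> divergence (cycle_flow r c) v = 0.
Proof.
move=> dc; rewrite /divergence sum_cycle_flow ?directed_cycle_uniq //.
case/and3P: dc => _ cc _.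
rewrite sumrB -(big_map src xpredT (fun x => (x == v)%:R)).
rewrite -(big_map tgt xpredT (fun x => (x == v)%:R)) map_target_cycle //.
by rewrite (perm_big _ (permEl (perm_rot 1 (map src c)))) /= subrr mulr0.
Qed.

Lemma divergenceB h1 h2 v :
  divergence (fun a => h1 a - h2 a) v = divergence h1 v - divergence h2 v.
Proof. by rewrite -sumrB; apply: eq_bigr => a _; rewrite mulrBl. Qed.

(** A positive edge into a vertex forces one out of it, so following chosen edges never gets stuck,
    and finiteness makes the walk periodic. *)
Lemma support_cycle h a0 :
    (forall a, 0 <= h a) -> (forall v, divergence h v = 0) -> 0 < h a0 ->
  exists2 c, directed_cycle c & all (fun a => 0 < h a) c.
Proof.
move=> h_ge0 h_div ha0.
(* The default is taken only at vertices without a positive outgoing edge, which the walk avoids. *)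
pose out v := odflt a0 [pick a | (0 < h a) && (src a == v)].
have outP v a : 0 < h a -> src a = v -> 0 < h (out v) /\ src (out v) = v.
  move=> ha <-; rewrite /out; case: pickP => [b /andP[-> /eqP ->] //|].
  by move/(_ a); rewrite ha eqxx.
(* Otherwise the divergence at [tgt a] would have no positive term and a negative one from [a]. *)
have leave a : 0 < h a -> exists2 b, 0 < h b & src b = tgt a.
  move=> ha; have [b /andP[hb /eqP]|no_out] :=
    pickP (fun b => (0 < h b) && (src b == tgt a)); first by exists b.
  have := h_div (tgt a); rewrite /divergence => div0.
  suff: \sum_b h b * ((src b == tgt a)%:R - (tgt b == tgt a)%:R) < 0.
    by rewrite div0 ltxx.
  rewrite (bigD1 a) //= eqxx.
  have := no_out a; rewrite ha /= => ->; rewrite sub0r mulrN1.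
  apply: ltr_wnDr; last by rewrite oppr_lt0.
  apply: sumr_le0 => b _; have := no_out b.
  case: (src b == tgt a); rewrite ?andbT => hb.
    by move: (h_ge0 b); rewrite le_eqVlt hb orbF => /eqP <-; rewrite mul0r.
  by rewrite sub0r mulrN oppr_le0 mulr_ge0.
pose nxt v := tgt (out v).
pose good v := 0 < h (out v) /\ src (out v) = v.
have good_nxt v : good v -> good (nxt v).
  by case=> hv _; have [b hb sb] := leave _ hv; apply: outP hb sb.
have good0 : good (src a0) by exact: outP ha0 erefl.
(* The walk comes back to its [i]-th vertex, so its orbit from there on is a cycle. *)
have /trajectP[i lt_i def_i] := looping_order nxt (src a0).
set y := iter i nxt (src a0).
have good_iter k : good (iter k nxt (src a0)) by elim: k => //= k; exact: good_nxt.
have fy : fcycle nxt (orbit nxt y).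
  apply/(orbitPcycle 0 3); exists (order nxt (src a0) - i).-1.
  by rewrite prednK ?subn_gt0 // /y -iterD subnK // ltnW.
have goods v : v \in orbit nxt y -> good v.
  by case/trajectP=> k _ ->; rewrite /y -iterD; exact: good_iter.
exists (map out (orbit nxt y)); last first.
  by apply/allP => _ /mapP[v /goods[hv _] ->].
have src_out : map src (map out (orbit nxt y)) = orbit nxt y.
  rewrite -map_comp -[RHS]map_id; apply/eq_in_map => v /goods[_]; exact.
apply/and3P; split; first by rewrite size_map size_orbit order_gt0.
  rewrite cycle_map; apply: (@sub_in_cycle _ (mem (orbit nxt y)) _ _ _ _ _ fy); last exact/allP.
  by move=> u v _ /goods[_ sv] /= /eqP uv; rewrite sv -uv.
by rewrite src_out orbit_uniq.
Qed.

(* If the cycle found in the support has nonpositive weight, subtracting it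
   with the least value of [h] on it shrinks the support without decreasing the
   total weight. *)
Lemma positive_weight_cycle (w : A -> F) h :
    (forall a, 0 <= h a) -> (forall v, divergence h v = 0) ->
    0 < \sum_a h a * w a ->
  exists c, [/\ directed_cycle c, all (fun a => 0 < h a) c
              & 0 < \sum_(a <- c) w a].
Proof.
have [n] := ubnP #|[pred a | 0 < h a]|; elim: n h => // n IH h le_n h_ge0 h_div pos.
have [a0 /= ha0|h_le0] := pickP [pred a | 0 < h a]; last first.
  have: \sum_a h a * w a = 0; last by move=> E; rewrite E ltxx in pos.
  apply: big1 => a _; move: (h_ge0 a) (h_le0 a).
  by rewrite le_eqVlt /= => /orP[/eqP <-|->] //; rewrite mul0r.
have [c dc hc] := support_cycle h_ge0 h_div ha0.
have [wc|wc] := ltP 0 (\sum_(a <- c) w a); first by exists c.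
have [x xc] : exists x, x \in c.
  by case: (c) dc => // x c' _; exists x; rewrite mem_head.
case: (@arg_minP _ _ _ x [in c] h xc) => m /= mc m_min.
have hm : 0 < h m by exact: (allP hc).
pose h' a := h a - cycle_flow (h m) c a.
have h'_le a : h' a <= h a.
  by rewrite /h' gerBl /cycle_flow mulr_ge0 // ltW.
have [||||d [dd hd wd]] := IH h'.
- rewrite -ltnS; apply: leq_trans le_n; rewrite ltnS; apply: proper_card; apply/properP; split.
    by apply/subsetP => a; rewrite !inE => /lt_le_trans; apply.
  by exists m; rewrite !inE // /h' /cycle_flow mc mulr1 subrr ltxx.
- move=> a; rewrite /h' /cycle_flow; case: (boolP (a \in c)) => ac.
    by rewrite mulr1 subr_ge0 m_min.
  by rewrite mulr0 subr0.
- by move=> v; rewrite divergenceB h_div divergence_cycle_flow // subrr.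
- apply: lt_le_trans pos _; under [leRHS]eq_bigr do rewrite mulrBl.
  rewrite sumrB sum_cycle_flow ?directed_cycle_uniq // lerDl oppr_ge0.
  by rewrite pmulr_rle0.
by exists d; split=> //; apply: sub_all hd => a /lt_le_trans; apply.
Qed.

End CycleDecomposition.

(** * Residual edges as a finite type *)

Section ResidualEdgeFinite.
Variable V : finType.

(** The bijection with three copies of [V * V] transfers finiteness, which sums over all residual
    edges need. *)
Definition residual_code (a : residual_edge V) : (V * V) + (V * V) + (V * V) :=
  match a with
  | Forward e => inl (inl e) | Backward e => inl (inr e) | Social e => inr e
  end.

Definition residual_decode (x : (V * V) + (V * V) + (V * V)) : residual_edge V :=
  match x with
  | inl (inl e) => Forward e | inl (inr e) => Backward e | inr e => Social e
  end.

Lemma residual_codeK : cancel residual_code residual_decode.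
Proof. by case. Qed.

Lemma residual_decodeK : cancel residual_decode residual_code.
Proof. by case=> [[]|]. Qed.

HB.instance Definition _ :=
  Finite.copy (residual_edge V) (can_type residual_codeK).

Lemma sum_residual_edge (M : nmodType) (F : residual_edge V -> M) :
  \sum_a F a
  = \sum_e F (Forward e) + \sum_e F (Backward e) + \sum_e F (Social e).
Proof.
rewrite (reindex residual_decode) /=; last first.
  by exists residual_code => a _; rewrite (residual_codeK, residual_decodeK).
by rewrite !big_sumType.
Qed.

End ResidualEdgeFinite.

(** * Flow changes induced by functions on residual edges *)

Lemma rev_edgeK (V : finType) : involutive (@rev_edge V).
Proof. by case. Qed.

Section Push.
Variables (V : finType) (N : network V).
Implicit Types (f g : flow V) (a : residual_edge V) (c : seq (residual_edge V)).
Implicit Types (h : residual_edge V -> rat) (e : V * V).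

Local Notation div := (divergence (@source V) (@target V)).

(** This is [in_residual] without positivity of the residual capacity, hence independent of the
    flow. *)
Definition edge_of a : bool :=
  match a with
  | Forward e | Backward e => e \in ER N
  | Social e => e \in ES N
  end.

(** With [pushS], the net change of a flow when [h a] units are sent along every residual edge
    [a]. *)
Definition pushR h e : rat := h (Forward e) - h (Backward e).
Definition pushS h e : rat := h (Social e) - h (Social (rev_edge e)).

Definition incidence e v : rat := (e.1 == v)%:R - (e.2 == v)%:R.

(** Social edges count at their tail only: by antisymmetry the reverse edge already records what
    flows in. *)
Definition outflow (xR xS : V * V -> rat) v : rat :=
  \sum_(e in ER N) xR e * incidence e v
  + \sum_(e in ES N) xS e * (e.1 == v)%:R.

Lemma sum_out_edges (A : {set V * V}) (x : V * V -> rat) v :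
  \sum_(e in A) x e * (e.1 == v)%:R = \sum_(j | (v, j) \in A) x (v, j).
Proof.
rewrite big_mkcond [RHS]big_mkcond /=.
pose G i j := if (i, j) \in A then x (i, j) * (i == v)%:R else 0.
transitivity (\sum_p G p.1 p.2); first by apply: eq_bigr => -[].
rewrite -(pair_bigA _ G) (bigD1 v) //= [X in _ + X]big1 ?addr0.
  by apply: eq_bigr => j _; rewrite /G eqxx mulr1.
by move=> i /negPf iv; apply: big1 => j _; rewrite /G iv mulr0 if_same.
Qed.

Lemma sum_in_edges (A : {set V * V}) (x : V * V -> rat) v :
  \sum_(e in A) x e * (e.2 == v)%:R = \sum_(j | (j, v) \in A) x (j, v).
Proof.
pose B : {set V * V} := [set e | rev_edge e \in A].
transitivity (\sum_(e in B) x (rev_edge e) * (e.1 == v)%:R).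
  rewrite (reindex_inj (inv_inj (@rev_edgeK V))) /=.
  by apply: eq_bigl => e; rewrite inE.
by rewrite sum_out_edges; apply: eq_bigl => j; rewrite inE.
Qed.

(** Conservation becomes the vanishing of a linear functional, so flow changes can be treated
    additively. *)
Lemma conservation_outflow f v :
  (\sum_(j | (v, j) \in ER N) fR f (v, j)
   + \sum_(j | (v, j) \in ES N) fS f (v, j)
   = \sum_(j | (j, v) \in ER N) fR f (j, v))
  <-> outflow (fR f) (fS f) v = 0.
Proof.
rewrite -!sum_out_edges -sum_in_edges /outflow.
under [in X in _ <-> X]eq_bigr do rewrite mulrBr.
by rewrite sumrB; split=> H; lra.
Qed.

Lemma outflowD xR yR xS yS v :
  outflow (fun e => xR e + yR e) (fun e => xS e + yS e) v
  = outflow xR xS v + outflow yR yS v.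
Proof.
rewrite /outflow addrACA -!big_split /=.
by congr (_ + _); apply: eq_bigr => e _; rewrite mulrDl.
Qed.

Lemma eq_outflow xR yR xS yS v :
  {in ER N, xR =1 yR} -> {in ES N, xS =1 yS} ->
  outflow xR xS v = outflow yR yS v.
Proof.
by move=> eqR eqS; congr (_ + _); apply: eq_bigr => e eN; rewrite (eqR, eqS).
Qed.

Hypothesis N_wf : well_formed N.

Lemma revES e : (rev_edge e \in ES N) = (e \in ES N).
Proof. by case: N_wf. Qed.

(** This links cycles to circulations: a divergence-free [h] changes a flow without disturbing
    conservation. *)
Lemma divergence_push h v :
  (forall a, ~~ edge_of a -> h a = 0) -> div h v = outflow (pushR h) (pushS h) v.
Proof.
move=> h0; rewrite /divergence sum_residual_edge /= /outflow.
rewrite -big_split /= [X in _ = X + _]big_mkcond /=; congr (_ + _).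
  apply: eq_bigr => e _; rewrite /pushR /incidence.
  case: ifPn => eN; first by ring.
  by rewrite !h0 //= !mul0r addr0.
under eq_bigr do rewrite mulrBr.
(* Reversing the social edges in the second sum turns inflow into outflow of the reverse edge. *)
rewrite sumrB [X in _ - X](reindex_inj (inv_inj (@rev_edgeK V))) /= -sumrB.
rewrite [RHS]big_mkcond /=; apply: eq_bigr => e _; rewrite /pushS.
case: ifPn => eN; first by rewrite mulrBl.
by rewrite !h0 ?mul0r ?subrr //= revES.
Qed.

Lemma weight_push h :
  (forall a, ~~ edge_of a -> h a = 0) ->
  \sum_a h a * weight N a = \sum_(e in ER N) util N e * pushR h e.
Proof.
move=> h0; rewrite sum_residual_edge /= [X in _ + X]big1 ?addr0; last first.
  by move=> e _; rewrite mulr0.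
rewrite -big_split [RHS]big_mkcond /=; apply: eq_bigr => e _; rewrite /pushR.
case: ifPn => eN; first by ring.
by rewrite !h0 //= !mul0r addr0.
Qed.

(** It ensures that the two writes of a social push hit different entries. *)
Lemma no_loopS e : e \in ES N -> rev_edge e != e.
Proof.
case: N_wf => _ noS _ _ _; case: e => i j; apply: contraTneq => -[-> _].
by rewrite noS.
Qed.

(** Multiplicities let the induction run over arbitrary edge lists; on a simple cycle they become
    indicators. *)
Lemma augment_fR r c f e :
  fR (augment_t r c f).1 e
  = fR f e + r * ((count_mem (Forward e) c)%:R - (count_mem (Backward e) c)%:R).
Proof.
have eqF e1 e2 : (Forward e1 == Forward e2) = (e1 == e2) by apply/eqP/eqP => [[]|->].
have eqB e1 e2 : (Backward e1 == Backward e2) = (e1 == e2) by apply/eqP/eqP => [[]|->].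
elim: c f => [|a c IH] f; first by rewrite /= subrr mulr0 addr0.
have -> : (augment_t r (a :: c) f).1 = (augment_t r c (push_t r a f).1).1.
  by rewrite /= /bind; case: (push_t r a f) => f' t' /=; case: (augment_t r c f').
rewrite IH; case: a => d /=; rewrite ?eqF ?eqB !natrD.
- by rewrite [e == d]eq_sym; case: eqVneq => [->|_] /=; ring.
- by rewrite [e == d]eq_sym; case: eqVneq => [->|_] /=; ring.
- by ring.
Qed.

Lemma augment_fS r c f e :
  all edge_of c ->
  fS (augment_t r c f).1 e
  = fS f e + r * ((count_mem (Social e) c)%:R
                  - (count_mem (Social (rev_edge e)) c)%:R).
Proof.
have eqS e1 e2 : (Social e1 == Social e2) = (e1 == e2) by apply/eqP/eqP => [[]|->].
elim: c f => [|a c IH] f; first by rewrite /= subrr mulr0 addr0.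
move=> /=/andP[aN /IH {}IH].
have -> : (augment_t r (a :: c) f).1 = (augment_t r c (push_t r a f).1).1.
  by rewrite /= /bind; case: (push_t r a f) => f' t' /=; case: (augment_t r c f').
rewrite IH; case: a aN => d /= dN; rewrite ?eqS !natrD; [by ring..|].
rewrite -[d == rev_edge e](inj_eq (inv_inj (@rev_edgeK V))) rev_edgeK.
rewrite ![e == _]eq_sym; case: eqVneq => [<-|_] /=.
  by rewrite (negPf (no_loopS dN)) /=; ring.
by case: eqVneq => [<-|_] /=; ring.
Qed.

End Push.

Local Arguments bind : simpl never.

(** * Bottleneck capacity and operation counts *)

Section TimedOperations.
Variables (V : finType) (N : network V) (f : flow V).
Implicit Types (a : residual_edge V) (c : seq (residual_edge V)).

Lemma bindE (S T : Type) (m : timed S) (k : S -> timed T) :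
  bind m k = ((k m.1).1, m.2 + (k m.1).2)%N.
Proof. by rewrite /bind; case: m => x t /=; case: (k x). Qed.

Lemma min_cap_tE r c :
  (min_cap_t N f r c).1 = foldl (fun r a => Num.min r (res_cap N f a)) r c.
Proof. by elim: c r => //= a c IH r; rewrite !bindE /= IH. Qed.

(** Being attained, the minimum inherits positivity and integrality from the residual capacities. *)
Lemma cycle_cap_attained c :
  (0 < size c)%N -> exists2 a, a \in c & (cycle_cap_t N f c).1 = res_cap N f a.
Proof.
case: c => //= a c _; rewrite bindE /= min_cap_tE -/(res_cap N f a).
elim: c a => [|b c IH] a /=; first by exists a; rewrite ?mem_head.
have [_|_] := leP (res_cap N f a) (res_cap N f b).
  have [d dc ->] := IH a; exists d => //.
  by move: dc; rewrite !inE => /orP[->|->]; rewrite ?orbT.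
by have [d dc ->] := IH b; exists d; rewrite // inE dc orbT.
Qed.

Lemma cycle_cap_le c a : a \in c -> (cycle_cap_t N f c).1 <= res_cap N f a.
Proof.
have foldl_le r s : foldl (fun r a => Num.min r (res_cap N f a)) r s <= r.
  by elim: s r => //= b s IH r; apply: le_trans (IH _) _; rewrite ge_min lexx.
case: c => //= b c; rewrite bindE /= min_cap_tE -/(res_cap N f b) inE.
case/predU1P => [->|]; first exact: foldl_le.
elim: c (res_cap N f b) => //= d c IH r; rewrite inE => /predU1P[->|/IH //].
by apply: le_trans (foldl_le _ _) _; rewrite ge_min lexx orbT.
Qed.

(** Each edge costs at most one subtraction and one comparison. *)
Lemma cycle_cap_time c : ((cycle_cap_t N f c).2 <= 2 * size c)%N.
Proof.
have cap1 a : ((res_cap_t N f a).2 <= 1)%N by case: a.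
have min_time r s : ((min_cap_t N f r s).2 <= 2 * size s)%N.
  elim: s r => //= a s IH r; rewrite !bindE /= mulnS addnA.
  by apply: leq_add => //; rewrite addn1 ltnS.
case: c => //= a c; rewrite bindE /= mulnS; apply: leq_add => //.
exact: leq_trans (cap1 a) _.
Qed.

(** The worst case is a social edge, with one addition and one subtraction. *)
Lemma augment_time r c g : ((augment_t r c g).2 <= 2 * size c)%N.
Proof.
elim: c g => //= a c IH g; rewrite bindE mulnS.
by apply: leq_add (IH _); case: a.
Qed.

End TimedOperations.

(** * Augmentation along a simple residual cycle *)

Section Augmentation.
Variables (V : finType) (N : network V) (f : flow V).
Hypotheses (N_wf : well_formed N) (f_circ : circulation N f).
Variable c : seq (residual_edge V).
Hypothesis c_cycle : simple_cycle N f c.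

Lemma cycle_edge_of : all (edge_of N) c.
Proof.
by case/and4P: c_cycle => _ + _ _; apply: sub_all => -[] e /andP[].
Qed.

Lemma simple_directed_cycle : directed_cycle (@source V) (@target V) c.
Proof. by case/and4P: c_cycle => ? _ ? ?; apply/and3P. Qed.

Lemma cycle_flow_supported (r : rat) a : ~~ edge_of N a -> cycle_flow r c a = 0.
Proof.
move=> aN; rewrite /cycle_flow; case: (boolP (a \in c)) => [ac|]; last by rewrite mulr0.
by rewrite (allP cycle_edge_of) in aN.
Qed.

Lemma cycle_augment_fR r e :
  fR (augment_t r c f).1 e = fR f e + pushR (cycle_flow r c) e.
Proof.
rewrite augment_fR /pushR /cycle_flow !count_uniq_mem ?mulrBr //;
  exact: directed_cycle_uniq simple_directed_cycle.
Qed.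

Lemma cycle_augment_fS r e :
  fS (augment_t r c f).1 e = fS f e + pushS (cycle_flow r c) e.
Proof.
rewrite (augment_fS N_wf) ?cycle_edge_of // /pushS /cycle_flow.
rewrite !count_uniq_mem ?mulrBr //;
  exact: directed_cycle_uniq simple_directed_cycle.
Qed.

Lemma augment_circulation r :
  0 <= r -> {in c, forall a, r <= res_cap N f a} ->
  circulation N (augment_t r c f).1.
Proof.
move=> r_ge0 r_le; case: f_circ => capS_f anti capR_f cons.
have le_S e : e \in ES N -> fS (augment_t r c f).1 e <= capS N e.
  move=> eN; rewrite cycle_augment_fS /pushS /cycle_flow.
  have /andP[_ le_cap] := capS_f e eN.
  have := r_le (Social e); rewrite /res_cap /=.
  by case: (_ \in c) => [/(_ isT)|_]; case: (_ \in c) => /=; lra.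
have anti' e : e \in ES N ->
    fS (augment_t r c f).1 (rev_edge e) = - fS (augment_t r c f).1 e.
  by move=> eN; rewrite !cycle_augment_fS anti // /pushS rev_edgeK; ring.
split=> [e eN|//|e eN|v].
(* The lower bound is the upper bound of the reverse edge, read through antisymmetry. *)
- rewrite le_S // andbT lerNl -anti' //; apply: le_S.
  by rewrite (revES N_wf).
- rewrite cycle_augment_fR /pushR /cycle_flow.
  have /andP[ge0 le_cap] := capR_f e eN.
  have := r_le (Forward e); have := r_le (Backward e); rewrite /res_cap /=.
  (* If both directions lie on [c] the changes cancel; a single one is bounded by its residual
     capacity. *)
  case: (Forward e \in c); case: (Backward e \in c) => /=.
  - by lra.
  - by move=> _ /(_ isT); lra.
  - by move=> /(_ isT) + _; lra.
  - by lra.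
apply/conservation_outflow.
rewrite (eq_outflow _ (in1W (cycle_augment_fR r)) (in1W (cycle_augment_fS r))).
rewrite outflowD (conservation_outflow N f v).1 // add0r.
rewrite -divergence_push ?divergence_cycle_flow //.
  exact: simple_directed_cycle.
exact: cycle_flow_supported.
Qed.

Lemma augment_utility r :
  total_utility N (augment_t r c f).1
  = total_utility N f + r * \sum_(a <- c) weight N a.
Proof.
rewrite /total_utility; under eq_bigr do rewrite cycle_augment_fR mulrDr.
rewrite big_split /= -weight_push; last exact: cycle_flow_supported.
rewrite sum_cycle_flow //; exact: directed_cycle_uniq simple_directed_cycle.
Qed.

Lemma augment_integer r :
  r \is a Num.int -> integer_circulation N f ->
  circulation N (augment_t r c f).1 ->
  integer_circulation N (augment_t r c f).1.
Proof.
move=> r_int [_ intR intS] circ'; split=> // e eN.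
  rewrite augment_fR rpredD ?intR // rpredM // rpredB //; exact: natr_int.
rewrite (augment_fS N_wf) ?cycle_edge_of // rpredD ?intS // rpredM // rpredB //;
  exact: natr_int.
Qed.

Lemma simple_cycle_size : (size c <= #|V|)%N.
Proof.
case/and4P: c_cycle => _ _ _ uc; rewrite -(size_map (@source V)).
by rewrite -(card_uniqP uc) max_card.
Qed.

End Augmentation.

(* The positive parts of [g - f] form a nonnegative divergence-free function on
   the residual edges whose total weight is the utility gained. *)
Lemma improving_cycle (V : finType) (N : network V) (f g : flow V) :
  well_formed N -> circulation N f -> circulation N g ->
  total_utility N f < total_utility N g -> exists c, positive_cycle N f c.
Proof.
move=> N_wf [capS_f anti_f capR_f cons_f] [capS_g anti_g capR_g cons_g] lt_fg.
pose gain a := match a with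
  | Forward e => fR g e - fR f e
  | Backward e => fR f e - fR g e
  | Social e => fS g e - fS f e
  end.
pose h a := if edge_of N a then Num.max 0 (gain a) else 0.
(* Opposite residual edges carry the two positive parts, whose difference restores [g - f]. *)
have posB (x y : rat) : Num.max 0 (x - y) - Num.max 0 (y - x) = x - y.
  by have [] := leP 0 (x - y); have [] := leP 0 (y - x); lra.
have h_supp a : ~~ edge_of N a -> h a = 0 by rewrite /h => /negPf ->.
have h_ge0 a : 0 <= h a by rewrite /h; case: ifP => // _; rewrite le_max lexx.
have hR e : e \in ER N -> pushR h e = fR g e - fR f e.
  by move=> eN; rewrite /pushR /h /= eN posB.
have hS e : e \in ES N -> pushS h e = fS g e - fS f e.
  move=> eN; rewrite /pushS /h /= revES // eN anti_g // anti_f //.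
  by rewrite opprK [- _ + _]addrC posB.
have [v||c [/and3P[c_gt0 c_cyc c_uniq] c_pos wc]] :=
    @positive_weight_cycle _ _ _ (@source V) (@target V) (weight N) h h_ge0.
- rewrite (divergence_push N_wf) // (eq_outflow v hR hS).
  have := (conservation_outflow N g v).1 (cons_g v).
  rewrite (eq_outflow (yR := fun e => fR f e + (fR g e - fR f e))
                      (yS := fun e => fS f e + (fS g e - fS f e)) v);
    [|by move=> e _; rewrite addrC subrK..].
  by rewrite outflowD (conservation_outflow N f v).1 // add0r.
- rewrite weight_push //; under eq_bigr => e eN do rewrite hR // mulrBr.
  by rewrite sumrB subr_gt0.
exists c; rewrite /positive_cycle wc andbT; apply/and4P; split=> //.
(* Where the gain is positive, the bounds on [g] leave [f] strictly positive residual capacity. *)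
apply: sub_all c_pos => a; rewrite /h; case: ifPn => [aN|]; last by rewrite ltxx.
rewrite lt_max ltxx /= => gain_a; rewrite /in_residual -/(edge_of N a) aN /=.
case: a aN gain_a => e /= eN; rewrite /res_cap /=.
- by have := capR_g e eN; lra.
- by have := capR_g e eN; lra.
- by have := capS_g e eN; lra.
Qed.

(** * Termination and running time of the loop *)

Section Termination.
Variables (find : cycle_finder) (V : finType) (N : network V).
Hypotheses (find_correct : finds_positive_cycles find) (N_wf : well_formed N).
Hypothesis capR_int : {in ER N, forall e, capR N e \is a Num.int}.
Hypothesis capS_int : {in ES N, forall e, capS N e \is a Num.int}.
Hypothesis util_int : {in ER N, forall e, util N e \is a Num.int}.

Lemma res_cap_int f a :
  integer_circulation N f -> edge_of N a -> res_cap N f a \is a Num.int.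
Proof.
move=> [_ intR intS]; case: a => e eN; rewrite /res_cap /=.
- by rewrite rpredB ?capR_int ?intR.
- exact: intR.
- by rewrite rpredB ?capS_int ?intS.
Qed.

Lemma weight_int a : edge_of N a -> weight N a \is a Num.int.
Proof. by case: a => e eN //=; rewrite ?rpredN util_int. Qed.

Lemma int_gt0_ge1 (x : rat) : x \is a Num.int -> 0 < x -> 1 <= x.
Proof. by case/intrP=> m ->; rewrite ltr0z ler1z gtz0_ge1. Qed.

Variant iteration_spec f : option (flow V) * nat -> Prop :=
  | IterationStop t of (forall c, ~~ positive_cycle N f c) :
      iteration_spec f (None, t)
  | IterationStep f' t of integer_circulation N f'
      & total_utility N f + 1 <= total_utility N f' :
      iteration_spec f (Some f', t).

(** Bottleneck and cycle weight are positive integers, so their product, the gain, is at least 1. *)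
Lemma iterationP f :
  integer_circulation N f -> iteration_spec f (iteration_t find N f).
Proof.
move=> f_int; have f_circ : circulation N f by case: f_int.
have := find_correct N_wf f_circ; rewrite /iteration_t bindE.
case: (find N f).1 => [c|no_pos]; last by constructor.
rewrite !bindE /= => /andP[c_cyc wc]; set r := (cycle_cap_t N f c).1.
have /and4P[c_gt0 c_res _ _] := c_cyc.
have [a ac r_def] := cycle_cap_attained N f c_gt0.
have r_int : r \is a Num.int.
  by rewrite /r r_def res_cap_int // (allP (cycle_edge_of c_cyc)).
have r_gt0 : 0 < r by rewrite /r r_def; have /andP[] := allP c_res a ac.
have w_ge1 : 1 <= \sum_(b <- c) weight N b.
  apply: int_gt0_ge1 wc; rewrite big_seq; apply: rpred_sum => b bc.
  by rewrite weight_int // (allP (cycle_edge_of c_cyc)).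
constructor.
  apply: augment_integer => //; apply: augment_circulation => //.
    exact: ltW.
  by move=> b; exact: cycle_cap_le.
rewrite augment_utility // lerD2l -[1]mulr1.
by apply: ler_pM => //; apply: int_gt0_ge1.
Qed.

(** Computing the bottleneck and augmenting each cost two operations per edge at most, on at most
    [#|V|] edges. *)
Lemma iteration_time f : circulation N f ->
  ((iteration_t find N f).2 <= (find N f).2 + 4 * #|V|)%N.
Proof.
move=> f_circ; have := find_correct N_wf f_circ; rewrite /iteration_t bindE /=.
case: (find N f).1 => [c /andP[c_cyc _]|_]; last by rewrite addn0 leq_addr.
rewrite !bindE /= addn0 leq_add2l.
apply: leq_trans (leq_add (cycle_cap_time _ _ _) (augment_time _ _ _)) _.
by rewrite -mulnDl leq_mul2l (simple_cycle_size c_cyc).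
Qed.

(** Each augmentation closes the gap to [W] by at least 1, so [n] bounds the iterations, the final
    failed test included. [T] comes after the run because a bound on one iteration is available only
    under the hypotheses of the time estimate. *)
Lemma cancel_loop_terminates (W : rat) (n : nat) f :
    (forall g, circulation N g -> total_utility N g <= W) ->
    integer_circulation N f -> W - total_utility N f < n%:R ->
  exists g t, [/\ cancel_loop find N f g t, integer_circulation N g,
    forall c, ~~ positive_cycle N g c
    & forall T, (forall f', circulation N f' ->
                            ((iteration_t find N f').2 <= T)%N) ->
                (t <= n * T)%N].
Proof.
move=> W_ub; elim: n f => [|n IH] f f_int lt_n.
  have f_circ : circulation N f by case: f_int.
  by have := W_ub f f_circ; rewrite leNgt -subr_lt0 lt_n.
have f_circ : circulation N f by case: f_int.
case E : (iteration_t find N f) (iterationP f_int) => [of' t] spec.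
case: spec E => [{}t no_pos|f' {}t f'_int f'_ge] E.
  exists f, t; split=> //; first exact: LoopStop.
  by move=> T /(_ f f_circ); rewrite E /= => /leq_trans; apply; rewrite leq_pmull.
have [|g [t' [loop g_int g_opt time]]] := IH f' f'_int.
  by move: lt_n; rewrite -natr1; lra.
exists g, (t + t')%N; split=> //; first exact: LoopStep E loop.
move=> T T_ub; rewrite mulSn leq_add ?time //.
by have := T_ub f f_circ; rewrite E.
Qed.

End Termination.

(** * Rounding capacities and scaling utilities *)

Section Rounding.
Variables (V : finType) (N : network V) (K : nat).

Lemma rounded_well_formed : well_formed N -> well_formed (rounded N K).
Proof.
case=> noR noS rev capR_ge0 capS_ge0; split=> //= e eN.
  by rewrite ler0z floor_ge0 capR_ge0.
by rewrite ler0z floor_ge0 capS_ge0.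
Qed.

Lemma le_floor_int (x y : rat) :
  x \is a Num.int -> (x <= (Num.floor y)%:~R) = (x <= y).
Proof. by case/intrP=> m ->; rewrite ler_int floor_ge_int. Qed.

(** An integer is at most a capacity iff it is at most its floor; lower bounds on social edges
    follow by negation. *)
Lemma rounded_integer_circulation f :
  well_formed N ->
  integer_circulation (rounded N K) f <-> integer_circulation N f.
Proof.
move=> N_wf.
have floorS (x a b : rat) : x \is a Num.int ->
    (- (Num.floor a)%:~R <= x <= (Num.floor b)%:~R) = (- a <= x <= b).
  by move=> x_int; rewrite lerNl !le_floor_int ?rpredN // lerNl.
split=> -[[capS_f anti capR_f cons] intR intS]; split=> //; split=> //= e eN.
- by rewrite -floorS ?intS ?capS_f.
- by rewrite -le_floor_int ?intR ?capR_f.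
- by rewrite floorS ?intS ?capS_f.
- by rewrite le_floor_int ?intR ?capR_f.
Qed.

Lemma rounded_utility f :
  total_utility (rounded N K) f = K%:R * total_utility N f.
Proof. by rewrite mulr_sumr; apply: eq_bigr => e _; rewrite mulrA. Qed.

End Rounding.

(** * Initial flow, utility bound and conclusion *)

Lemma zero_flow_integer (V : finType) (N : network V) :
  well_formed N -> integer_circulation N (zero_flow V).
Proof.
move=> N_wf; have revN := revES N_wf; case: N_wf => _ _ _ capR_ge0 capS_ge0.
split; [|by move=> e _; exact: rpred0..].
split=> /= [e eN|e _|e eN|v]; rewrite ?oppr0 //.
- by rewrite oppr_le0 !capS_ge0 ?revN.
- by rewrite capR_ge0.
by rewrite !big1 ?addr0.
Qed.

(** Utilities may be negative; such edges contribute at most 0, hence the maximum with 0. *)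
Lemma utility_le (V : finType) (N : network V) (f : flow V) :
  circulation N f ->
  total_utility N f <= \sum_(e in ER N) Num.max 0 (util N e) * capR N e.
Proof.
case=> _ _ capR_f _; apply: ler_sum => e eN; have /andP[f_ge0 f_le] := capR_f e eN.
apply: (@le_trans _ _ (Num.max 0 (util N e) * fR f e)).
  by rewrite ler_wpM2r // le_max lexx orbT.
by rewrite ler_wpM2l // le_max lexx.
Qed.

Theorem theorem4 (find : cycle_finder)
    (find_correct : finds_positive_cycles find)
    (find_time : finder_time_O_VE find) :
  exists C : nat,
  forall (V : finType) (N : network V) (K : nat),
    social_request_graph N ->
    (0 < K)%N ->
    (forall e, e \in ER N -> K%:R * util N e \is a Num.int) ->
    exists (f : flow V) (t : nat),
      [/\ cycle_canceling find (rounded N K) f t,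
          optimal_integer_flow N f
        & forall Ubar Rbar : rat,
            is_max (ER N) (util N) Ubar ->
            is_max (ER N) (capR N) Rbar ->
            0 < time_bound N K Ubar Rbar ->
            t%:R <= C%:R * time_bound N K Ubar Rbar].
Proof.
have [C0 find_le] := find_time.
(* [C0] pays for the finder and 4 for the rest of an iteration; 2 absorbs the extra iteration in
   [(Num.truncn W).+1]. *)
exists (2 * (C0 + 4))%N => V N K [N_wf _ _] K_gt0 util_int.
set M := rounded N K; have M_wf : well_formed M := rounded_well_formed K N_wf.
pose W := \sum_(e in ER M) Num.max 0 (util M e) * capR M e.
have W_ge0 : 0 <= W.
  apply: sumr_ge0 => e eN; rewrite mulr_ge0 ?le_max ?lexx //.
  by case: M_wf => _ _ _ ->.
have [||||g [t [loop g_int g_opt time]]] := @cancel_loop_terminates find V M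
    find_correct M_wf _ _ _ W (Num.truncn W).+1 (zero_flow V)
    (@utility_le V M) (zero_flow_integer M_wf).
- by move=> e _; exact: intr_int.
- by move=> e _; exact: intr_int.
- exact: util_int.
- rewrite [total_utility _ _]big1 ?subr0 ?truncnS_gt // => e _; exact: mulr0.
exists g, t; split=> //.
  split; first by apply/(rounded_integer_circulation K g N_wf).
  (* A better flow would give a positive cycle at [g], where the loop has stopped. *)
  move=> f /(rounded_integer_circulation K f N_wf) f_int.
  rewrite leNgt; apply/negP => lt_gf.
  have [[g_circ _ _] [f_circ _ _]] := (g_int, f_int).
  have [|c] := improving_cycle M_wf g_circ f_circ; last exact/negP.
  by rewrite !rounded_utility ltr_pM2l ?ltr0n.
move=> Ubar Rbar [[e0 e0N Ubar_def] Ubar_max] [_ Rbar_max].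
set B := (#|V| * (#|ES N| + #|ER N|))%N.
(* [P] bounds the total scaled utility and [B] measures the cost of one iteration. *)
pose P : rat := #|ER N|%:R * (Num.floor Rbar)%:~R * (K%:R * Ubar).
have -> : time_bound N K Ubar Rbar = B%:R * P.
  by rewrite /time_bound /B /P natrM natrD; ring.
move=> BP_gt0.
have ER_gt0 : (0 < #|ER N|)%N by apply/card_gt0P; exists e0.
have V_gt0 : (0 < #|V|)%N by apply/card_gt0P; exists e0.1.
have B_gt0 : (0 < B)%N by rewrite muln_gt0 V_gt0 addn_gt0 ER_gt0 orbT.
have P_gt0 : 0 < P by rewrite pmulr_rgt0 ?ltr0n in BP_gt0.
(* [Ubar] is attained at [e0], so [K%:R * Ubar] and with it [P] is an integer. *)
have P_ge1 : 1 <= P.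
  apply: int_gt0_ge1 P_gt0.
  by rewrite /P -Ubar_def rpredM ?util_int // rpredM ?intr_int ?natr_int.
have floorR_ge0 : 0 <= (Num.floor Rbar)%:~R :> rat.
  rewrite ler0z floor_ge0; apply: le_trans (Rbar_max e0 e0N).
  by case: N_wf => _ _ _ ->.
(* This lets [K%:R * Ubar] dominate the maxima with 0 in [W]. *)
have KU_ge0 : 0 <= K%:R * Ubar.
  rewrite leNgt; apply/negP => KU_lt0; move: P_gt0; rewrite ltNge => /negP; apply.
  by rewrite /P mulr_ge0_le0 ?mulr_ge0 // ltW.
have W_le : W <= P.
  rewrite /P -mulrA [X in X * _](_ : _ = \sum_(e in ER N) 1); last by rewrite sumr_const.
  rewrite mulr_suml; apply: ler_sum => e eN; rewrite mul1r mulrC.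
  apply: ler_pM; rewrite ?le_max ?lexx //=.
  - by case: M_wf => _ _ _ ->.
  - by rewrite ler_int le_floor ?Rbar_max.
  - by rewrite ge_max KU_ge0 ler_wpM2l ?Ubar_max.
have t_le : (t <= (Num.truncn W).+1 * ((C0 + 4) * B))%N.
  apply: time => f f_circ; apply: leq_trans (iteration_time _ _ f_circ) _ => //.
  (* As [ER N] is nonempty, [#|V| <= B]. *)
  rewrite mulnDl leq_add ?find_le //= leq_mul2l /= leq_pmulr //.
  by rewrite addn_gt0 ER_gt0 orbT.
(* Both [W] and 1 are at most [P]. *)
have n_le : (Num.truncn W).+1%:R <= 2 * P.
  have : (Num.truncn W)%:R <= W by rewrite truncn_le.
  by rewrite -natr1; lra.
apply: le_trans (_ : ((Num.truncn W).+1 * ((C0 + 4) * B))%N%:R <= _).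
  by rewrite ler_nat.
have -> : (2 * (C0 + 4))%:R * (B%:R * P) = (2 * P) * ((C0 + 4) * B)%:R.
  by rewrite !natrM; ring.
by rewrite natrM ler_wpM2r.
Qed.
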